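(* Let $n\ge 1$. Let $\alpha\in D_n$ be defined by $x\alpha=\max(1,x-1)$ for all $x\in X_n$, and let $\alpha''\in T_n$ be given by $1\alpha''=1$ and $x\alpha''=\min(x+1,n)$ for all $x\in X_n$ with $x>1$. Then $$\mathrm{Dom}_{T_n}(D_n)=\langle D_n\cup\{\alpha''\}\rangle .$$
   Context: $X_n=\{1,2,\dots,n\}$ is the finite chain with its usual order, and $T_n$ is the full transformation semigroup of all maps $X_n\to X_n$. Maps are written on the right and composed left to right: $x(\alpha\beta)=(x\alpha)\beta$. $D_n=\{\alpha\in T_n: x\alpha\le x \text{ for all } x\in X_n\}$ is the subsemigroup of order-decreasing maps. For a subset $A\subseteq T_n$, $\langle A\rangle$ denotes the subsemigroup of $T_n$ generated by $A$. For a subsemigroup $U$ of a semigroup $S$, an element $d\in S$ is dominated by $U$ if for every semigroup $T$ and all semigroup homomorphisms $f,g:S\to T$ with $f|_U=g|_U$ one has $(d)f=(d)g$; the dominion $\mathrm{Dom}_S(U)$ is the set of all elements of $S$ dominated by $U$ (a subsemigroup of $S$ containing $U$). *)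

(* Defs.v *)
From HB Require Import structures.
From mathcomp Require Import all_boot.
From mathcomp Require Import boolp classical_sets.

Set Implicit Arguments.
Unset Strict Implicit.
Unset Printing Implicit Defensive.

Local Open Scope group_scope.
Local Open Scope classical_set_scope.

Definition subsemigroup (S : semigroupType) (A : set S) : Prop :=
  forall x y : S, A x -> A y -> A (x * y).

Definition sgenerated (S : semigroupType) (A : set S) : set S :=
  smallest (@subsemigroup S) A.

(* A semigroupType carries a choice structure; classically this excludes no
   semigroup, since every type can be given one. *)
Definition dominated (S : semigroupType) (U : set S) (d : S) : Prop :=
  forall (T : semigroupType) (f g : {multiplicative S -> T}),
    (forall u : S, U u -> f u = g u) -> f d = g d.

Definition Dom (S : semigroupType) (U : set S) : set S :=
  [set d | dominated U d].

(* The chain 1 < 2 < ... < n is represented by 'I_n, whose values start at 0. *)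
Definition label (n : nat) (x : 'I_n) : nat := x.+1.

Definition transf (n : nat) : Type := {ffun 'I_n -> 'I_n}.

HB.instance Definition _ (n : nat) := Finite.on (transf n).

(* Maps act on the right and compose from left to right: x(ab) = (xa)b. *)
Definition transf_mul (n : nat) (a b : transf n) : transf n :=
  [ffun x => b (a x)].

Lemma transf_mulA (n : nat) : associative (@transf_mul n).
Proof. by move=> a b c; apply/ffunP => x; rewrite !ffunE. Qed.

HB.instance Definition _ (n : nat) :=
  isSemigroup.Build (transf n) (@transf_mulA n).

Definition order_decreasing (n : nat) : set (transf n) :=
  [set a | forall x : 'I_n, label (a x) <= label x].

Arguments order_decreasing : clear implicits.

(* Main.v *)
(** Both sides consist of the identity and the non-injective maps fixing the
    least point.  A boolean function [phi] on pairs with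
    [phi (s u) t = phi s (u t)] for [u] in [U] yields two homomorphisms into a
    split extension that agree on [U]; two choices of [phi] show that every
    element of the dominion fixes the least point and that the only injective
    one is the identity.  Conversely, a singular map fixing the least point
    misses some other value; shifting the values above it down by one step, then
    bubble-sorting the values by adjacent exchanges, leads to a decreasing map,
    and each step is undone by [alpha''] followed by a decreasing map.
    Finally, if [n >= 3] then [alpha''] is dominated since
    [alpha'' alpha alpha'' = alpha''] with [alpha alpha''] and [alpha'' alpha]
    decreasing; for smaller [n] it is itself decreasing. *)

Require Import Defs.
From HB Require Import structures.
From mathcomp Require Import all_boot.
From mathcomp Require Import boolp classical_sets.
From mathcomp Require Import zify.

Local Open Scope classical_set_scope.

(** * Split extensions and dominions *)

(* The semidirect product of [S] with its bimodule of Z/2-valued functions on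
   [S x S], on which [S] acts by right and left translations of the arguments. *)
Definition pairing_ext (S : semigroupType) : Type :=
  (S * (S -> S -> bool))%type.

HB.instance Definition _ (S : semigroupType) := Choice.on (pairing_ext S).

Definition pairing_mul (S : semigroupType) (p q : pairing_ext S) :
    pairing_ext S :=
  ((p.1 * q.1)%g, fun a b => p.2 a (q.1 * b)%g (+) q.2 (a * p.1)%g b).

Lemma pairing_mulA (S : semigroupType) : associative (@pairing_mul S).
Proof.
move=> [s1 m1] [s2 m2] [s3 m3]; rewrite /pairing_mul /= !mulgA.
congr pair; apply/funext => a; apply/funext => b.
by rewrite !mulgA addbA.
Qed.

HB.instance Definition _ (S : semigroupType) :=
  isSemigroup.Build (pairing_ext S) (@pairing_mulA S).

(* [phi] is balanced over [U] iff the inner derivation it defines vanishes on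
   [U]. *)
Definition inner_hom (S : semigroupType) (phi : S -> S -> bool) (s : S) :
    pairing_ext S :=
  (s, fun a b => phi (a * s)%g b (+) phi a (s * b)%g).

Lemma inner_homM (S : semigroupType) (phi : S -> S -> bool) :
  {morph inner_hom S phi : s t / (s * t)%g}.
Proof.
move=> s t; rewrite /inner_hom; congr pair.
apply/funext => a; apply/funext => b; rewrite /= !mulgA.
by case: (phi (a * s)%g _); case: (phi (a * s * t)%g _); case: (phi a _).
Qed.

HB.instance Definition _ (S : semigroupType) (phi : S -> S -> bool) :=
  isMultiplicative.Build S (pairing_ext S) (inner_hom S phi) (inner_homM S phi).

Lemma dominated_balanced {S : semigroupType} {U : set S} {d : S}
    (phi : S -> S -> bool) :
    (forall u s t, U u -> phi (s * u)%g t = phi s (u * t)%g) ->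
  Dom U d -> forall s t, phi (s * d)%g t = phi s (d * t)%g.
Proof.
move=> phiU Dd s t.
(* The constant function gives the trivial section, with which that of [phi] is compared. *)
have := Dd (pairing_ext S) (inner_hom S phi) (inner_hom S (fun=> fun=> false)).
move=> /(_ _)/(congr1 (fun p : pairing_ext S => p.2 s t)) /= E.
suff /E : forall u : S, U u ->
    inner_hom S phi u = inner_hom S (fun=> fun=> false) u.
  by case: (phi _ _); case: (phi _ _).
move=> u Uu; congr pair; apply/funext => a; apply/funext => b.
by rewrite phiU // addbb.
Qed.

Lemma subsemigroup_Dom (S : semigroupType) (U : set S) : subsemigroup (Dom U).
Proof.
by move=> x y Dx Dy T f g fg; rewrite !gmulfM (Dx _ _ _ fg) (Dy _ _ _ fg).
Qed.

Lemma sub_Dom (S : semigroupType) (U : set S) : U `<=` Dom U.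
Proof. by move=> u Uu T f g; apply. Qed.

(* The zigzag [b = (b a) b = b a b = b (a b)] moves [b] across [U]. *)
Lemma Dom_inverse (S : semigroupType) (U : set S) (a b : S) :
  U a -> U (a * b)%g -> U (b * a)%g -> (b * a * b)%g = b -> Dom U b.
Proof.
move=> Ua Uab Uba bab T f g fg.
rewrite -{1}bab gmulfM (fg _ Uba) gmulfM -(fg _ Ua) -mulgA -gmulfM (fg _ Uab).
by rewrite -gmulfM mulgA bab.
Qed.

(** * Constraints on maps dominated by the decreasing ones *)

Lemma transfE {n : nat} (a b : transf n) (x : 'I_n) : (a * b)%g x = b (a x).
Proof. by rewrite ffunE. Qed.

Lemma order_decreasingP (n : nat) (a : transf n) :
  order_decreasing n a <-> forall x, a x <= x.
Proof. by []. Qed.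

Definition transf1 (n : nat) : transf n := [ffun x => x].

Lemma transf1_mul {n : nat} (a : transf n) : (transf1 n * a)%g = a.
Proof. by apply/ffunP => x; rewrite transfE ffunE. Qed.

Lemma transf_mul1 {n : nat} (a : transf n) : (a * transf1 n)%g = a.
Proof. by apply/ffunP => x; rewrite transfE ffunE. Qed.

(** If [a x < x], induction gives [a (a x) = a x], and injectivity yields [a x = x]. *)
Lemma order_decreasing_inj {n : nat} {a : transf n} :
  order_decreasing n a -> injective a -> a = transf1 n.
Proof.
move=> /order_decreasingP aD ainj; apply/ffunP => x; rewrite ffunE.
have [k] := ubnP (x : nat); elim: k x => // k IH x; rewrite ltnS => xk.
have := aD x; rewrite leq_eqVlt => /orP[/eqP/val_inj //|axx].
by apply: ainj; apply: IH; apply: leq_trans axx xk.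
Qed.

Lemma Dom_decreasing_fix0 {n : nat} {d : transf n.+1} :
  Dom (order_decreasing n.+1) d -> d ord0 = ord0.
Proof.
move=> Dd; pose phi (s t : transf n.+1) := t ord0 == ord0.
have phiU (u s t : transf n.+1) : order_decreasing n.+1 u ->
    phi (s * u)%g t = phi s (u * t)%g.
  move=> /order_decreasingP uD; rewrite /phi transfE.
  suff -> : u ord0 = ord0 by [].
  by apply/val_inj; have := uD ord0; case: (u ord0) => -[].
have := dominated_balanced phi phiU Dd (transf1 _) (transf1 _).
by rewrite /phi transf_mul1 ffunE eqxx => /esym/eqP.
Qed.

Lemma Dom_decreasing_inj {n : nat} {d : transf n} :
  Dom (order_decreasing n) d -> injective d -> d = transf1 n.
Proof.
(* Each of [s * u = d] and injectivity of [u * t] forces [u] to be injective, hence the identity. *)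
move=> Dd dinj; pose phi (s t : transf n) := (s == d) && injectiveb t.
have phiU (u s t : transf n) : order_decreasing n u ->
    phi (s * u)%g t = phi s (u * t)%g.
  move=> uD; have [uinj|uninj] := pselect (injective u).
    by rewrite (order_decreasing_inj uD uinj) transf1_mul transf_mul1.
  apply/idP/idP => /andP[/eqP sE /injectiveP tinj]; exfalso; apply: uninj.
    have suinj : injective (s * u)%g by rewrite sE.
    have sinj : injective s by move=> x y xy; apply: suinj; rewrite !transfE xy.
    have [s' _ s'K] := injF_bij sinj.
    move=> x y uxy; rewrite -(s'K x) -(s'K y); congr (s _); apply: suinj.
    by rewrite !transfE !s'K.
  by move=> x y uxy; apply: tinj; rewrite !transfE uxy.
have := dominated_balanced phi phiU Dd (transf1 _) (transf1 _).
rewrite /phi transf1_mul transf_mul1 eqxx.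
have -> : injectiveb (transf1 n) by apply/injectiveP => x y; rewrite !ffunE.
by move=> /esym/andP[/eqP <-].
Qed.

(** * Generating the singular maps *)

Definition transf_of_nat (n : nat) (g : nat -> nat) : transf n.+1 :=
  [ffun x : 'I_n.+1 => inord (g x)].

Lemma transf_of_natE {n : nat} (g : nat -> nat) (x : 'I_n.+1) :
  g x <= n -> transf_of_nat n g x = g x :> nat.
Proof. by move=> gx; rewrite ffunE inordK. Qed.

Lemma missed_value {n : nat} (f : transf n) :
  ~ injective f -> exists h, forall x, f x <> h.
Proof.
move=> fninj; apply: contrapT => /forallNP fsurj; apply: fninj.
have /choice[g gK] : forall h, exists x, f x = h.
  by move=> h; apply: contrapT => /forallNP; apply: fsurj.
exact: bij_inj (bij_can_bij (injF_bij (can_inj gK)) gK).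
Qed.

Section Generation.
Context (n : nat) (b : transf n.+1) (G : set (transf n.+1)).
Hypotheses (b0 : b ord0 = ord0)
  (bE : forall x : 'I_n.+1, 0 < x -> x < n -> b x = x.+1 :> nat)
  (Gsub : subsemigroup G)
  (GD : order_decreasing n.+1 `<=` G) (Gb : G b).

(** As [f x < n], [b] raises nonzero values by exactly one; from there, the map [g z.-1 <= z] is
    decreasing and reaches [g (f x)]. *)
Lemma raise_mem (g : nat -> nat) (f h : transf n.+1) :
    g 0 = 0 -> (forall y, g y <= y.+1) ->
    G f -> (forall x, f x < n) -> (forall x, h x = g (f x) :> nat) -> G h.
Proof.
move=> g0 gle Gf fn hE.
pose d := transf_of_nat n (fun z => g z.-1).
have gz (z : nat) : g z.-1 <= z by case: z => [|z]; rewrite /= ?g0.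
have dE (x : 'I_n.+1) : d x = g x.-1 :> nat.
  by rewrite transf_of_natE // (leq_trans (gz x)) // -ltnS.
have -> : h = (f * (b * d))%g.
  apply/ffunP => x; apply/val_inj; rewrite !transfE /= dE hE.
  have [fx0|fx0] := posnP (f x).
    have -> : f x = ord0 by apply/val_inj.
    by rewrite b0.
  by rewrite bE.
apply: (Gsub _ _ Gf); apply: (Gsub _ _ Gb); apply: GD.
by apply/order_decreasingP => x; rewrite dE.
Qed.

Definition swapn (y z : nat) : nat :=
  if z == y then y.-1 else if z == y.-1 then y else z.

(* Lexicographic descent on the sequence of values of [f]: if [x] is the first
   point with [f x > x], exchanging the values [f x - 1] and [f x] leaves the
   values at the points before [x] untouched. *)
Lemma low_mem_from (k : nat) (f : transf n.+1) :
    f ord0 = ord0 -> (forall x, f x < n) ->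
    (forall x : 'I_n.+1, x < n.+1 - k -> f x <= x) -> G f.
Proof.
elim: k f => [|k IHk] f f0 fn fD.
  by apply/GD/order_decreasingP => x; apply: fD; rewrite subn0.
have [kn|kn] := leqP n.+1 k; first by apply: IHk => // x; lia.
pose x : 'I_n.+1 := inord (n - k).
have xE : x = n - k :> nat by rewrite inordK //; lia.
(* Each exchange lowers the value at [x] by one, until it is at most [x]. *)
have [m] := ubnP (f x : nat); elim: m f f0 fn fD => // m IHm f f0 fn fD fxm.
have [fx|fx] := leqP (f x) x.
  apply: IHk => // z zk; have [->//|zx] := eqVneq z x.
  by apply: fD; have : (z : nat) != x by []; lia.
have x0 : 0 < x.
  rewrite lt0n; apply: contraTneq fx => x0.
  by rewrite (_ : x = ord0) ?f0 //; apply/val_inj.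
pose f' := transf_of_nat n (fun z => swapn (f x) (f (inord z))).
have f'E z : f' z = swapn (f x) (f z) :> nat.
  rewrite transf_of_natE inord_val //.
  by have := fn z; have := fn x; rewrite /swapn; do ?case: ifP; lia.
have swapK z : swapn (f x) (swapn (f x) z) = z.
  by rewrite /swapn; do ?case: ifP; lia.
apply: (raise_mem (swapn (f x)) f') => [|y||z|z].
- by rewrite /swapn; do ?case: ifP; lia.
- by rewrite /swapn; do ?case: ifP; lia.
- apply: IHm => [|z|z zk|].
  + by apply/val_inj; rewrite /= f'E f0 /swapn /=; do ?case: ifP; lia.
  + by rewrite f'E; have := fn z; have := fn x; rewrite /swapn; do ?case: ifP; lia.
  (* [f z <= z < x < f x] puts [f z] below both exchanged values. *)
  + by rewrite f'E; have := fD z zk; rewrite /swapn; do ?case: ifP; lia.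
  + by rewrite f'E /swapn eqxx; lia.
- by rewrite f'E; have := fn z; have := fn x; rewrite /swapn; do ?case: ifP; lia.
- by rewrite f'E swapK.
Qed.

Lemma singular_mem (f : transf n.+1) :
  f ord0 = ord0 -> ~ injective f -> G f.
Proof.
move=> f0 /missed_value[h fh].
have h0 : 0 < h.
  by rewrite lt0n; apply/eqP => h0; apply: (fh ord0); rewrite f0; apply/val_inj.
have fhN x : (f x : nat) <> h by move=> /val_inj; apply: fh.
(* Closing the gap at [h] brings all values below [n]; [y + (h <= y)] reopens it. *)
pose f' := transf_of_nat n (fun z => f (inord z) - (h < f (inord z))).
have f'E z : f' z = f z - (h < f z) :> nat.
  by rewrite transf_of_natE inord_val //; have := ltn_ord (f z); lia.
apply: (raise_mem (fun y => y + (h <= y)) f') => [|y||z|z].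
- lia.
- lia.
- apply: (low_mem_from n.+1) => [|z|z].
  + by apply/val_inj; rewrite /= f'E f0.
  + by rewrite f'E; have := ltn_ord (f z); have := fhN z; have := ltn_ord h; lia.
  + by rewrite subnn.
- by rewrite f'E; have := ltn_ord (f z); have := fhN z; have := ltn_ord h; lia.
- by rewrite f'E; have := fhN z; lia.
Qed.

End Generation.

Theorem proposition2p2 (n : nat) (n_ge1 : 1 <= n)
    (alpha : transf n) (alpha_decr : order_decreasing n alpha)
    (alphaE : forall x : 'I_n, label (alpha x) = maxn 1 (label x - 1))
    (alpha'' : transf n)
    (alpha''1 : forall x : 'I_n, label x = 1 -> label (alpha'' x) = 1)
    (alpha''E : forall x : 'I_n,
        1 < label x -> label (alpha'' x) = minn (label x + 1) n) :
  Dom (order_decreasing n) = sgenerated (order_decreasing n `|` [set alpha'']).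
Proof.
case: n => // n in n_ge1 alpha alpha_decr alphaE alpha'' alpha''1 alpha''E *.
rewrite /label in alphaE alpha''1 alpha''E.
have aE x : alpha x = x.-1 :> nat by have := alphaE x; lia.
have b0 : alpha'' ord0 = ord0 by apply/val_inj; case: (alpha''1 ord0 erefl).
have bE (x : 'I_n.+1) : 0 < x -> alpha'' x = minn x.+1 n :> nat.
  by move=> x0; have := alpha''E x; lia.
have bD : Dom (order_decreasing n.+1) alpha''.
  have b0' (x : 'I_n.+1) : (x : nat) = 0 -> alpha'' x = 0 :> nat.
    by move=> x0; rewrite (_ : x = ord0) ?b0 //; apply/val_inj.
  (* With at most two points [alpha''] is decreasing; otherwise [n - 1 > 0], so [alpha''] sends
     [n - 1] back to the top [n]. *)
  have [n1|n1] := leqP n 1.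
    apply: sub_Dom; apply/order_decreasingP => x.
    by have := bE x; have := b0' x; lia.
  apply: (Dom_inverse _ _ alpha) => //.
  + apply/order_decreasingP => x; rewrite transfE.
    by have := bE (alpha x); have := b0' (alpha x); rewrite aE; have := ltn_ord x; lia.
  + apply/order_decreasingP => x; rewrite transfE aE.
    by have := bE x; have := b0' x; lia.
  + apply/ffunP => x; apply/val_inj; rewrite /= !transfE.
    have := bE (alpha (alpha'' x)); have := b0' (alpha (alpha'' x)); rewrite aE.
    by have := bE x; have := b0' x; have := ltn_ord x; lia.
apply/seteqP; split => [d Dd G [Gsub GU]|]; last first.
  apply: smallest_sub; first exact: subsemigroup_Dom.
  by move=> x [/sub_Dom//|->].
have GD : order_decreasing n.+1 `<=` G by move=> x xD; apply: GU; left.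
have [/(Dom_decreasing_inj Dd) ->|dninj] := pselect (injective d).
  by apply/GD/order_decreasingP => x; rewrite ffunE.
apply: (singular_mem n alpha'') => //.
- by move=> x x0 xn; rewrite bE //; lia.
- by apply: GU; right.
- exact: Dom_decreasing_fix0.
Qed.
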